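(* Let $c$ be a smooth closed curve in $\mathbb{H}^1$ which is a graph over its projection $\bar c$ to the $xy$-plane. If $c$ has no Legendrian points and no portion of $c$ (i.e. no $c(I)$ with $I$ a nondegenerate interval) is contained in a plane, then an H-minimal surface spanning $c$ cannot be a $C^1$ ruled H-minimal surface.
   Context: The Heisenberg group $\mathbb{H}^1$ is $\mathbb{R}^3$ with coordinates $(x,y,t)$ and vector fields $X_1=\partial_x-\frac y2\partial_t$, $X_2=\partial_y+\frac x2\partial_t$, $T=\partial_t$. A point $c(\theta_0)$ is Legendrian if $c'(\theta_0)\in\mathrm{span}\{X_1,X_2\}$ at $c(\theta_0)$. For a $C^1$ graph $t=u(x,y)$ over $\Omega\subset\mathbb{R}^2$ put $p=X_1(t-u)$, $q=X_2(t-u)$; characteristic points are those with $p=q=0$ (the characteristic locus is the set of these), and elsewhere the unit horizontal Gauss map is $(\bar p,\bar q)=(p,q)/\sqrt{p^2+q^2}$. The graph is H-minimal if $\int_\Omega\bar p\,\phi_x+\bar q\,\phi_y\,dx\,dy=0$ for all $\phi\in C_0^\infty(\Omega)$. A $C^1$ ruled H-minimal surface (graph) over a closed domain $\Omega\subset\mathbb{R}^2$ is a $C^1$ H-minimal graph that is, away from the characteristic locus, a ruled surface whose rules are horizontal straight lines (lifts of the integral curves of $(\bar q,-\bar p)$), and such that every rule that meets the characteristic locus may be extended over the characteristic locus as a straight line. A graph $S$ spans $c$ if it is a graph over a closed domain $\Omega$ with $\partial\Omega=\bar c$ and its boundary is $c$.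
   Formalization: The closed domain Ω over which the surface spans c is assumed bounded (the region enclosed by the projected curve), since for the unbounded exterior region the claim fails; ''closed curve'' is read as simple closed curve. *)

(* Defs.v *)
From HB Require Import structures.
From mathcomp Require Import all_boot all_order all_algebra.
From mathcomp Require Import all_classical all_reals all_analysis.
Set Implicit Arguments.
Unset Strict Implicit.
Unset Printing Implicit Defensive.
Import Order.TTheory GRing.Theory Num.Theory.
Import numFieldNormedType.Exports.
Local Open Scope classical_set_scope.
Local Open Scope ring_scope.

(* A point of the Heisenberg group is written ((x, y), t): the first component
   is its projection to the xy-plane. *)
Notation plane R := (R * R)%type.
Notation heis R := (R * R * R)%type.

Section Heisenberg.
Variable R : realType.
Implicit Types (z v : plane R) (a : heis R) (u : plane R -> R).
Implicit Types (Omega W : set (plane R)) (c : R -> heis R).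

Definition X1 a : heis R := ((1, 0), - (a.1.2 / 2)).
Definition X2 a : heis R := ((0, 1), a.1.1 / 2).

Definition horizontal a (w : heis R) : Prop :=
  exists alpha beta : R, w = alpha *: X1 a + beta *: X2 a.

Definition hline a v (s : R) : heis R :=
  a + s *: (v.1 *: X1 a + v.2 *: X2 a).

Definition is_plane (P : set (heis R)) : Prop :=
  exists A B C D : R, (A, B, C) != (0, 0, 0) /\
    P = [set a | A * a.1.1 + B * a.1.2 + C * a.2 = D].

(** Closed curves *)

Definition smooth_curve c : Prop :=
  forall (n : nat) (th : R), derivable (derive1n n c) th 1.

(* L-periodic, and injective modulo L. *)
Definition closed_curve c : Prop :=
  exists2 L : R, 0 < L &
    forall th th' : R, c th = c th' <-> exists k : int, th' = th + k%:~R * L.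

Definition graph_over_projection c : Prop := set_inj (range c) fst.

Definition legendrian c (th : R) : Prop := horizontal (c th) (derive1 c th).

(** Graphs t = u(x,y) over a closed domain *)

Definition dx (f : plane R -> R) z : R := 'D_((1, 0) : plane R) f z.
Definition dy (f : plane R -> R) z : R := 'D_((0, 1) : plane R) f z.

Fixpoint Ck (k : nat) W (f : plane R -> R) : Prop :=
  match k with
  | 0 => forall z, W z -> {for z, continuous f}
  | k'.+1 => [/\ forall z, W z -> differentiable f z,
                 Ck k' W (dx f) & Ck k' W (dy f)]
  end.

Definition closed_domain Omega : Prop :=
  exists U : set (plane R), [/\ open U, connected U, U !=set0 &
                                Omega = closure U].

Definition boundary (A : set (plane R)) : set (plane R) :=
  closure A `\` interior A.

(* C^1 up to the boundary: a graph over Omega is represented by the values on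
   Omega of a function that is C^1 on a neighbourhood of Omega. *)
Definition C1_graph Omega u : Prop :=
  exists W : set (plane R), [/\ open W, Omega `<=` W & Ck 1 W u].

Definition lift u z : heis R := (z, u z).

Definition graph Omega u : set (heis R) := lift u @` Omega.

Definition gp u z : R :=
  'D_(X1 (lift u z)) (fun a : heis R => a.2 - u a.1) (lift u z).
Definition gq u z : R :=
  'D_(X2 (lift u z)) (fun a : heis R => a.2 - u a.1) (lift u z).

(* Projection to the plane of the characteristic locus. *)
Definition char_locus Omega u : set (plane R) :=
  [set z | [/\ Omega z, gp u z = 0 & gq u z = 0]].

(* Meaningful off the characteristic locus; both equal 0 on it. *)
Definition pbar u z : R := gp u z / Num.sqrt (gp u z ^+ 2 + gq u z ^+ 2).
Definition qbar u z : R := gq u z / Num.sqrt (gp u z ^+ 2 + gq u z ^+ 2).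

Definition test_function Omega (phi : plane R -> R) : Prop :=
  [/\ forall k, Ck k setT phi,
      compact (closure [set z | phi z != 0]) &
      closure [set z | phi z != 0] `<=` interior Omega].

Definition Hminimal Omega u : Prop :=
  [/\ closed_domain Omega, C1_graph Omega u &
      forall phi, test_function Omega phi ->
        (\int[(@lebesgue_measure R \x @lebesgue_measure R)%E]_(z in Omega)
           (pbar u z * dx phi z + qbar u z * dy phi z)%:E)%E = 0%E].

(** Rules *)

Definition rule_dir u z : plane R := (qbar u z, - pbar u z).

(* The parameters s reached from s = 0 when moving along the straight line
   z + s v without leaving A. *)
Definition run (A : set (plane R)) z v : set R :=
  connected_component [set s : R | A (z + s *: v)] 0.

Definition rule Omega u z : set (heis R) :=
  hline (lift u z) (rule_dir u z) @`
    run (Omega `\` char_locus Omega u) z (rule_dir u z).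

(* As the tangent vector of s |-> z + s v is constantly v, the first conjunct
   says that this line is an integral curve of (qbar, - pbar) as long as it
   stays in Omega minus the characteristic locus. *)
Definition ruled_off_char_locus Omega u : Prop :=
  forall z, (Omega `\` char_locus Omega u) z ->
    (forall s, run (Omega `\` char_locus Omega u) z (rule_dir u z) s ->
       rule_dir u (z + s *: rule_dir u z) = rule_dir u z) /\
    rule Omega u z `<=` graph Omega u.

(* A rule meets the characteristic locus when it has an end point there; its
   straight extension then stays in the surface as long as it stays over
   Omega. *)
Definition rules_extend Omega u : Prop :=
  forall z, (Omega `\` char_locus Omega u) z ->
    closure (rule Omega u z) `&` graph (char_locus Omega u) u !=set0 ->
    hline (lift u z) (rule_dir u z) @` run Omega z (rule_dir u z)
      `<=` graph Omega u.

Definition C1_ruled_Hminimal Omega u : Prop :=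
  [/\ Hminimal Omega u, ruled_off_char_locus Omega u & rules_extend Omega u].

(* Compactness makes Omega the region enclosed by the projected curve: the
   unbounded complementary region has the same boundary. *)
Definition spans Omega u c : Prop :=
  [/\ closed_domain Omega, compact Omega,
      boundary Omega = range (fst \o c) &
      graph (boundary Omega) u = range c].

End Heisenberg.

(* Main.v *)
Require Import Defs.
From HB Require Import structures.
From mathcomp Require Import all_boot all_order all_algebra.
From mathcomp Require Import all_classical all_reals all_analysis.
From mathcomp Require Import ring lra zify.
Import Order.TTheory GRing.Theory Num.Theory.
Import numFieldNormedType.Exports.
Local Open Scope classical_set_scope.
Local Open Scope ring_scope.
Set Implicit Arguments.
Unset Strict Implicit.
Unset Printing Implicit Defensive.

(* Let g be the projection of c and (p, q) the horizontal gradient of t - u. That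
   c has no Legendrian point says that (p, q).g' never vanishes: no boundary
   point is characteristic, and the rules cross the boundary transversally, all
   inwards or all outwards when directed by (q, -p). A rule entering at one
   boundary point leaves at another one, where its inner direction is reversed;
   the lift of this whole chord is a horizontal segment of the surface, since
   rules extend over the characteristic locus. Sending an end point of a chord
   to the other one lifts to a continuous injection phi of the line with
   th < phi th < th + L and phi (phi th) = th + L, so phi is increasing. Hence
   nearby chords cross each other. Two chords meet at X; a third chord meets them
   at Y and Z, and XYZ lifts to a closed triangle with horizontal sides, so its
   area is 0 and the three chords are concurrent. All chords starting on an arc
   thus pass through X, and that arc of c lies in the horizontal plane at the
   point of the surface over X, which is excluded. *)

(** * Determinant and inner product of plane vectors *)

Definition cross (R : realType) (a b : plane R) : R := a.1 * b.2 - a.2 * b.1.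
Definition dot (R : realType) (a b : plane R) : R := a.1 * b.1 + a.2 * b.2.

Section CrossDot.
Variable R : realType.
Implicit Types (a b c : plane R) (s : R).

Lemma crossDr a b c : cross a (b + c) = cross a b + cross a c.
Proof. by rewrite /cross /=; ring. Qed.
Lemma crossNr a b : cross a (- b) = - cross a b.
Proof. by rewrite /cross /=; ring. Qed.
Lemma crossBr a b c : cross a (b - c) = cross a b - cross a c.
Proof. by rewrite crossDr crossNr. Qed.
Lemma crossZr a s b : cross a (s *: b) = s * cross a b.
Proof. by rewrite /cross /= /GRing.scale /=; ring. Qed.
Lemma crossC a b : cross a b = - cross b a.
Proof. by rewrite /cross; ring. Qed.
Lemma crossxx a : cross a a = 0.
Proof. by rewrite /cross; ring. Qed.
Lemma crossNl a b : cross (- a) b = - cross a b.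
Proof. by rewrite /cross /=; ring. Qed.
Lemma crossZl s a b : cross (s *: a) b = s * cross a b.
Proof. by rewrite /cross /= /GRing.scale /=; ring. Qed.
Lemma dotDl a b c : dot (a + b) c = dot a c + dot b c.
Proof. by rewrite /dot /=; ring. Qed.
Lemma dotZl s a b : dot (s *: a) b = s * dot a b.
Proof. by rewrite /dot /= /GRing.scale /=; ring. Qed.

End CrossDot.

Lemma int_small (R : realType) (k : int) : `|k%:~R : R| < 1 -> k = 0.
Proof.
rewrite -intr_norm (ltr_int R _ 1) => k1; lia.
Qed.

Lemma shift_into (R : realType) (L a t : R) : 0 < L ->
  exists k : int, a <= t + k%:~R * L < a + L.
Proof.
move=> L0; pose f := Num.floor ((t - a) / L); exists (- f).
have /andP[] := @Num.Theory.floor_itv R ((t - a) / L).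
rewrite -/f intrD ler_pdivlMr// ltr_pdivrMr// mulrDl mul1r rmorphN /= mulNr => h1 h2.
by apply/andP; split; lra.
Qed.

(** * Limits, connectedness and boundaries in the plane *)

Section PlaneTopology.
Variable R : realType.

Lemma cvg_fst_comp (T : Type) (F : set_system T) (FF : Filter F)
  (f : T -> plane R) (a : plane R) : f @ F --> a -> (fun t => (f t).1) @ F --> a.1.
Proof. by move=> fa; apply: (cvg_comp f fst fa); exact: cvg_fst. Qed.

Lemma cvg_snd_comp (T : Type) (F : set_system T) (FF : Filter F)
  (f : T -> plane R) (a : plane R) : f @ F --> a -> (fun t => (f t).2) @ F --> a.2.
Proof. by move=> fa; apply: (cvg_comp f snd fa); exact: cvg_snd. Qed.

Lemma cvg_cross (T : Type) (F : set_system T) (FF : Filter F)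
  (f g : T -> plane R) (a b : plane R) : f @ F --> a -> g @ F --> b ->
  (fun t => cross (f t) (g t)) @ F --> cross a b.
Proof.
move=> fa gb; apply: cvgB; apply: cvgM;
  by [apply: cvg_fst_comp|apply: cvg_snd_comp].
Qed.

Lemma cvg_dot (T : Type) (F : set_system T) (FF : Filter F)
  (f g : T -> plane R) (a b : plane R) : f @ F --> a -> g @ F --> b ->
  (fun t => dot (f t) (g t)) @ F --> dot a b.
Proof.
move=> fa gb; apply: cvgD; apply: cvgM;
  by [apply: cvg_fst_comp|apply: cvg_snd_comp].
Qed.

(** This comes from expanding [b] in the orthonormal basis formed by [a] and its rotation by a right
    angle. *)
Lemma cross0_unit (a b : plane R) : dot a a = 1 -> cross a b = 0 ->
  b = dot b a *: a.
Proof.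
case: a b => [a1 a2] [b1 b2]; rewrite /dot /cross /= => aa ab.
congr pair; rewrite /= /GRing.scale /=.
  transitivity (b1 * (a1 * a1 + a2 * a2) + a2 * (a1 * b2 - a2 * b1)); last by ring.
  by rewrite aa ab; ring.
transitivity (b2 * (a1 * a1 + a2 * a2) - a1 * (a1 * b2 - a2 * b1)); last by ring.
by rewrite aa ab; ring.
Qed.

(** As [A] is closed, a point of [A] off its boundary is interior. Hence [S] meets [A] in a set that
    is both open and closed in [S]. *)
Lemma connected_avoids_boundary (A S : set (plane R)) : closed A ->
  connected S -> S `&` boundary A = set0 ->
  S `<=` interior A \/ S `&` A = set0.
Proof.
move=> clA cS SA.
have AA : A = closure A by apply/closure_id.
have inA z : S z -> A z -> (interior A) z.
  move=> Sz Az; apply: contrapT => nz.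
  suff : (S `&` boundary A) z by rewrite SA.
  by split=> //; split=> //; rewrite -AA.
have [S0|/set0P S0] := eqVneq (S `&` A) set0; [by right|left].
suff -> : S = S `&` A by move=> z [] /inA.
apply/esym/cS => //; last by exists A.
exists (interior A); first exact: open_interior.
apply/seteqP; split=> z [Sz Az]; split=> //; first exact: inA.
exact: interior_subset Az.
Qed.

Lemma path_side (A : set (plane R)) (f : R -> plane R) : closed A ->
  continuous f -> (forall l, 0 <= l <= 1 -> ~ boundary A (f l)) ->
  (interior A (f 0) /\ interior A (f 1)) \/ (~ A (f 0) /\ ~ A (f 1)).
Proof.
move=> clA cf fA; pose S := f @` `[0, 1].
have cS : connected S.
  apply: connected_continuous_connected; first exact: segment_connected.
  exact: continuous_subspaceT.
have S0 : S (f 0) by exists 0 => //=; rewrite in_itv /= lexx ler01.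
have S1 : S (f 1) by exists 1 => //=; rewrite in_itv /= lexx ler01.
have SA : S `&` boundary A = set0.
  apply/seteqP; split=> // z [[l]]; rewrite /= in_itv /= => l01 <-.
  exact: fA.
have [SiA|SA0] := connected_avoids_boundary clA cS SA.
  by left; split; exact: SiA.
by right; split=> Af; [move: (f 0) S0 Af|move: (f 1) S1 Af] => z Sz Az;
  have : (S `&` A) z by []; rewrite SA0.
Qed.

End PlaneTopology.

(** * The two sides of a closed curve *)

Section Curve.
Variables (R : realType) (g dg v : R -> plane R) (L : R).
Hypothesis L_gt0 : 0 < L.
Hypothesis g_inj : forall s t, g s = g t <-> exists k : int, t = s + k%:~R * L.
Hypothesis g_der1 : forall t : R, is_derive t 1 (fun s => (g s).1) (dg t).1.
Hypothesis g_der2 : forall t : R, is_derive t 1 (fun s => (g s).2) (dg t).2.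
Hypothesis g_cont : continuous g.
Hypothesis dg_cont : continuous dg.
Hypothesis v_cont : continuous v.
Hypothesis v_unit : forall t, dot (v t) (v t) = 1.
Hypothesis v_transverse : forall t, 0 < cross (v t) (dg t).

(** The mean value theorem fails for plane-valued maps, but applies to the scalar function
    [cross a (g x)]. *)
Lemma cross_mean_value (a : plane R) (s t : R) : s < t ->
  exists2 xi, s < xi < t & cross a (g t - g s) = cross a (dg xi) * (t - s).
Proof.
move=> st; pose f x := cross a (g x).
have df (x : R) : is_derive x 1 f (cross a (dg x)).
  rewrite (_ : f = (a.1 \*: (fun s => (g s).2)) - (a.2 \*: (fun s => (g s).1)))//.
  exact: is_deriveB.
have [|xi] := @MVT _ f (fun x => cross a (dg x)) s t st (fun x _ => df x).
  apply: continuous_subspaceT => x.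
  by apply: cvg_cross; [exact: cvg_cst|exact: g_cont].
rewrite in_itv /= => xist fE; exists xi => //; rewrite -fE /f /cross /=.
ring.
Qed.

Lemma near_transverse (t0 : R) : exists2 e : R, 0 < e &
  forall s t, `|s - t0| < e -> `|t - t0| < e -> 0 < cross (v s) (dg t).
Proof.
have : (fun p : R * R => cross (v p.1) (dg p.2)) @ (t0, t0) -->
       cross (v t0) (dg t0).
  apply: cvg_cross.
    apply: (cvg_comp fst v _ (@v_cont t0)); exact: cvg_fst.
  apply: (cvg_comp snd dg _ (@dg_cont t0)); exact: cvg_snd.
move=> /cvgr_gt /(_ _ (v_transverse t0)) /nbhs_ballP[e /= e0 He].
exists e => // s t ss tt; apply: (He (s, t)).
by split; rewrite /= /ball /= distrC.
Qed.

(** A short arc advances strictly across each nearby direction [v a]. This monotonicity separates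
    points of the curve and later orders the end points of chords. *)
Lemma near_arc_transverse (t0 : R) : exists2 e : R, 0 < e &
  forall a s t, `|a - t0| < e -> `|s - t0| < e -> `|t - t0| < e -> s < t ->
    0 < cross (v a) (g t - g s).
Proof.
have [e e0 He] := near_transverse t0; exists e => // a s t ae se te st.
have [xi /andP[sxi xit] ->] := cross_mean_value (v a) st.
apply: mulr_gt0; last by rewrite subr_gt0.
apply: He => //.
by move: se te; rewrite !ltr_norml => /andP[? ?] /andP[? ?]; apply/andP; split; lra.
Qed.

(** The part of one period away from [t0] has a compact image that misses [g t0], so a whole ball
    around [g t0] misses it too. *)
Lemma curve_locally_embedded (t0 e : R) : 0 < e -> exists2 r : R, 0 < r &
  forall t, ball (g t0) r (g t) -> exists k : int, `|t + k%:~R * L - t0| < e.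
Proof.
move=> e0.
pose K : set R := `[t0 - L / 2, t0 + L / 2] `&` ~` [set t | `|t - t0| < e].
have cK : compact K.
  apply: compact_closedI; first exact: segment_compact.
  apply: open_closedC; rewrite (_ : [set _ | _] = ball t0 e); first exact: ball_open.
  by apply/seteqP; split=> t /=; rewrite /ball /= distrC.
have ng : ~ (g @` K) (g t0).
  move=> [t [/= tI te]] /g_inj[k tk]; apply: te.
  move: tI; rewrite /= in_itv /= => tI.
  rewrite tk (_ : k = 0) ?mul0r ?addr0 ?subrr ?normr0//.
  apply: (@int_small R); rewrite -(ltr_pM2r L_gt0) mul1r -[X in _ * X]gtr0_norm// -normrM.
  have L0 := L_gt0; move: tI => /andP[? ?].
  by rewrite ltr_norml; apply/andP; split; lra.
have cgK : compact (g @` K).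
  by apply: continuous_compact => //; exact: continuous_subspaceT.
have : nbhs (g t0) (~` (g @` K)).
  apply: open_nbhs_nbhs; split=> //; apply: closed_openC.
  by apply: compact_closed => //; exact: norm_hausdorff.
move=> /nbhs_ballP[r /= r0 Hr]; exists r => // t /Hr nK.
have [k /andP[k1 k2]] := shift_into (t0 - L / 2) t L_gt0.
exists k; apply: contrapT => ke; apply: nK; exists (t + k%:~R * L); last first.
  by apply: esym; apply/g_inj; exists k.
split; last exact: ke.
by rewrite /= in_itv /=; apply/andP; split; lra.
Qed.

(** * Inner and outer sides of a region along its boundary curve *)

Variable Omega : set (plane R).
Hypothesis Omega_closed : closed Omega.
Hypothesis Omega_boundary : boundary Omega = range g.
Hypothesis Omega_regular : Omega `<=` closure (interior Omega).

Lemma curve_in_Omega t : Omega (g t).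
Proof.
have : boundary Omega (g t) by rewrite Omega_boundary; exists t.
by move=> [+ _]; rewrite -(closure_id Omega).1.
Qed.

Lemma curve_notin_interior t : ~ interior Omega (g t).
Proof.
by have [_] : boundary Omega (g t) by rewrite Omega_boundary; exists t.
Qed.

(** A curve point on the transversal close to [g t] has, up to a period, a parameter near [t0]. The
    increment from [g t] is then parallel to [v t], which [near_arc_transverse] allows only at [g t]
    itself. *)
Lemma transversal_avoids_curve (t0 : R) : exists2 e : R, 0 < e &
  forall t s : R, `|t - t0| < e -> `|s| < e -> s != 0 ->
    ~ range g (g t + s *: v t).
Proof.
have [e1 e10 He1] := near_arc_transverse t0.
have [r r0 Hr] := curve_locally_embedded t0 e10.
have : (fun p : R * R => g p.1 + p.2 *: v p.1) @ (t0, 0 : R) --> g t0.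
  rewrite -[X in _ --> X]addr0 -(scale0r (v t0)); apply: cvgD.
    by apply: (cvg_comp fst g _ (@g_cont t0)); exact: cvg_fst.
  apply: cvgZ; first exact: cvg_snd.
  by apply: (cvg_comp fst v _ (@v_cont t0)); exact: cvg_fst.
move=> /(_ _ (nbhsx_ballx _ _ r0)) /nbhs_ballP[e2 /= e20 He2].
exists (Num.min e1 e2); first by rewrite lt_min e10.
move=> t s; rewrite !lt_min => /andP[te1 te2] /andP[_ se] s0 [t1 _ gt1].
have : ball (g t0) r (g t1).
  rewrite gt1; apply: (He2 (t, s)); split; rewrite /= /ball /= 1?distrC//.
  by rewrite subr0.
move=> /Hr[k]; have : g t1 = g (t1 + k%:~R * L) by apply/g_inj; exists k.
move: (t1 + _) => t2; rewrite gt1 => gt2 t2e.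
have c0 : cross (v t) (g t2 - g t) = 0.
  by rewrite -gt2 addrAC subrr add0r crossZr crossxx mulr0.
have [tt2|t2t|tt2] := ltgtP t t2.
- by have := He1 t t t2 te1 te1 t2e tt2; rewrite c0 ltxx.
- have := He1 t t2 t te1 t2e te1 t2t.
  by rewrite -[g t - g t2]opprB crossNr c0 oppr0 ltxx.
- have : s *: v t = 0 by move: gt2; rewrite -tt2 -[RHS]addr0 => /addrI.
  move=> /(congr1 (fun a => dot a (v t))); rewrite dotZl v_unit mulr1.
  rewrite /dot /= !mul0r addr0 => s00; by rewrite s00 eqxx in s0.
Qed.

(** As [v] is merely continuous, the intermediate value theorem for [cross (v t) (z - g t)] in [t]
    replaces the inverse function theorem: at a zero, [z - g t] is a multiple of [v t]. *)
Lemma near_curve_covered (t0 e : R) : 0 < e ->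
  \forall z \near g t0, exists t s, [/\ `|t - t0| < e, `|s| < e & z = g t + s *: v t].
Proof.
move=> e0; have [e1 e10 He1] := near_arc_transverse t0.
have : (fun p : plane R * R => dot (p.1 - g p.2) (v p.2)) @ (g t0, t0) -->
    dot (g t0 - g t0) (v t0).
  apply: cvg_dot; last by apply: (cvg_comp snd v _ (@v_cont t0)); exact: cvg_snd.
  apply: cvgB; first exact: cvg_fst.
  by apply: (cvg_comp snd g _ (@g_cont t0)); exact: cvg_snd.
rewrite subrr -(scale0r (v t0)) dotZl mul0r => /cvgr0_norm_lt/(_ _ e0).
move=> /nbhs_ballP[e2 /= e20 He2].
(* Halving makes the bounds strict, so that [t0 - e3] and [t0 + e3] stay inside all three
   windows. *)
pose e3 := Num.min e (Num.min e1 e2) / 2.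
have e30 : 0 < e3 by rewrite divr_gt0// !lt_min e0 e10.
have [e3e e3e1 e3e2] : [/\ e3 < e, e3 < e1 & e3 < e2].
  have : e3 * 2 <= e /\ e3 * 2 <= e1 /\ e3 * 2 <= e2.
    by rewrite /e3 divfK// !ge_min !lexx !orbT.
  by move=> [? [? ?]]; split; lra.
have ce (a b : R) : (fun z => cross (v a) (z - g b)) @ g t0 -->
    cross (v a) (g t0 - g b).
  by apply: cvg_cross; [exact: cvg_cst|apply: cvgB; [exact: cvg_id|exact: cvg_cst]].
have ap : `|t0 + e3 - t0| < e1 by rewrite addrAC subrr add0r gtr0_norm.
have am : `|t0 - e3 - t0| < e1 by rewrite addrAC subrr add0r normrN gtr0_norm.
have a0 : `|t0 - t0| < e1 by rewrite subrr normr0.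
near=> z.
have zp : cross (v (t0 + e3)) (z - g (t0 + e3)) < 0.
  near: z; apply: (cvgr_lt _ (ce _ (t0 + e3))).
  rewrite -[_ - _]opprB crossNr oppr_lt0; apply: He1 => //; lra.
have zm : 0 < cross (v (t0 - e3)) (z - g (t0 - e3)).
  near: z; apply: (cvgr_gt _ (ce _ (t0 - e3))).
  apply: He1 => //; lra.
have ze : ball (g t0) e2 z by near: z; exact: nbhsx_ballx.
have [|||t] := @IVT R (fun t => cross (v t) (z - g t)) (t0 - e3) (t0 + e3) 0.
- by lra.
- apply: continuous_subspaceT => t; apply: cvg_cross; first exact: v_cont.
  by apply: cvgB; [exact: cvg_cst|exact: g_cont].
- by rewrite ge_min le_max (ltW zm) (ltW zp) orbT.
rewrite in_itv /= => /andP[t1 t2] ct.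
have tt0 : `|t - t0| <= e3 by rewrite ler_norml; apply/andP; split; lra.
exists t, (dot (z - g t) (v t)); split.
- exact: (le_lt_trans tt0 e3e).
- by apply: (He2 (z, t)); split => //=; rewrite /ball /= distrC; exact: (le_lt_trans tt0 e3e2).
- by rewrite -(cross0_unit (v_unit t) ct) addrC subrK.
Unshelve. all: by end_near. Qed.

Lemma convex_lt (l x y c : R) : 0 <= l -> l <= 1 -> x < c -> y < c ->
  (1 - l) * x + l * y < c.
Proof.
rewrite le_eqVlt => /predU1P[<- _|l0 l1] xc yc; first by lra.
have : 0 < l * (c - y) by rewrite mulr_gt0// subr_gt0.
have : 0 <= (1 - l) * (c - x) by rewrite mulr_ge0// ?subr_ge0// ltW.
lra.
Qed.

(** Interpolating both parameters linearly joins the two points by a path. Its transversal parameter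
    never vanishes, as [s] and [s'] have the same sign, so the path avoids the boundary. *)
Lemma sides_constant (t0 e : R) :
  (forall t s : R, `|t - t0| < e -> `|s| < e -> s != 0 ->
    ~ range g (g t + s *: v t)) ->
  forall t s t' s' : R, `|t - t0| < e -> `|t' - t0| < e -> `|s| < e -> `|s'| < e ->
  0 < s * s' ->
  (interior Omega (g t + s *: v t) /\ interior Omega (g t' + s' *: v t')) \/
  (~ Omega (g t + s *: v t) /\ ~ Omega (g t' + s' *: v t')).
Proof.
move=> He t s t' s' te te' se se' ss'.
pose aff (a b l : R) := a + l * (b - a).
have caff a b : continuous (aff a b).
  move=> l; apply: cvgD; first exact: cvg_cst.
  by apply: cvgM; [exact: cvg_id|exact: cvg_cst].
pose f l := g (aff t t' l) + aff s s' l *: v (aff t t' l).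
have f0 : f 0 = g t + s *: v t by rewrite /f /aff !mul0r !addr0.
have f1 : f 1 = g t' + s' *: v t'.
  by rewrite /f /aff !mul1r !(addrC t) !(addrC s) !subrK.
have := @path_side R Omega f Omega_closed; rewrite f0 f1; apply.
  move=> l; apply: cvgD; first by apply: (cvg_comp _ g (@caff _ _ l)); exact: g_cont.
  apply: cvgZ; first exact: caff.
  by apply: (cvg_comp _ v (@caff _ _ l)); exact: v_cont.
have aff_norm a b l c : 0 <= l <= 1 -> `|a| < c -> `|b| < c -> `|aff a b l| < c.
  move=> /andP[l0 l1]; rewrite !ltr_norml => /andP[a1 a2] /andP[b1 b2].
  rewrite /aff (_ : a + _ = (1 - l) * a + l * b); last by ring.
  rewrite ltrNl; apply/andP; split; last exact: convex_lt.
  by rewrite opprD -!mulrN; apply: convex_lt => //; lra.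
move=> l l01; rewrite Omega_boundary; apply: He; last 1 first.
- apply/eqP => a0; have : 0 < s * aff s s' l.
    rewrite /aff (_ : _ * _ = - ((1 - l) * - (s * s) + l * - (s * s'))); last by ring.
    rewrite oppr_gt0; move/andP: l01 => [l0 l1]; apply: convex_lt => //; rewrite oppr_lt0//.
    by rewrite -expr2 exprn_even_gt0//=; apply: contraTneq ss' => ->; rewrite mul0r ltxx.
  by rewrite a0 mulr0 ltxx.
- rewrite (_ : aff t t' l - t0 = aff (t - t0) (t' - t0) l); first exact: aff_norm.
  by rewrite /aff; ring.
- exact: aff_norm.
Qed.

Definition inward (k t d : R) := forall s, 0 < s < d ->
  interior Omega (g t + (s * k) *: v t) /\ ~ Omega (g t - (s * k) *: v t).

(** Near [g t0] every point lies on the curve or on one of its two sides, and each side is wholly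
    inside or wholly outside. Exactly one is inside: two would make [g t0] interior, none would
    contradict [Omega_regular]. *)
Lemma local_sides (t0 : R) : exists2 e : R, 0 < e &
  exists2 k : R, k = 1 \/ k = -1 & forall t, `|t - t0| < e -> inward k t e.
Proof.
have [e e0 He] := transversal_avoids_curve t0; exists e => //.
have side := sides_constant He.
have t0e : `|t0 - t0| < e by rewrite subrr normr0.
have h0 : 0 < e / 2 by rewrite divr_gt0.
have he : `|e / 2| < e by rewrite gtr0_norm//; lra.
have hne : `|- (e / 2)| < e by rewrite normrN.
pose S (b : R) := g t0 + (b * (e / 2)) *: v t0.
have sideE (b : R) t s : b = 1 \/ b = -1 -> `|t - t0| < e -> 0 < s < e ->
  (interior Omega (S b) /\ interior Omega (g t + (s * b) *: v t)) \/
  (~ Omega (S b) /\ ~ Omega (g t + (s * b) *: v t)).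
  move=> b1 te /andP[s0 se]; rewrite /S; apply: side => //.
  - by case: b1 => ->; rewrite ?mul1r ?mulN1r.
  - by case: b1 => ->; rewrite ?mulr1 ?mulrN1 ?normrN gtr0_norm.
  - rewrite (_ : _ * _ = (b * b) * (s * (e / 2))); last by ring.
    by case: b1 => ->; rewrite ?mulrNN mulr1 mul1r mulr_gt0.
have cover := near_curve_covered t0 e0.
have subO := @interior_subset _ Omega.
have decomp (Q : plane R -> Prop) : (forall t, Q (g t)) ->
    (forall b t s, b = 1 \/ b = -1 -> `|t - t0| < e -> 0 < s < e ->
       Q (g t + (s * b) *: v t)) ->
    \forall z \near g t0, Q z.
  move=> Qg Qs; apply: filterS cover => z [t [s [te se ->]]].
  move: se; have [s0|s0|->] := ltgtP s 0; last by rewrite scale0r addr0.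
    rewrite ltr0_norm// => se; rewrite -(opprK s) -mulrN1; apply: Qs => //; first by right.
    by rewrite oppr_gt0 s0.
  rewrite gtr0_norm// => se; rewrite -(mulr1 s); apply: Qs => //; first by left.
  by rewrite s0.
have notboth : ~ (Omega (S 1) /\ Omega (S (-1))).
  move=> [in1 Om1]; apply: (@curve_notin_interior t0); apply: decomp.
    exact: curve_in_Omega.
  move=> b t s b1 te se; have [[_ /subO //]|[+ _]] := sideE b t s b1 te se.
  by case: b1 => ->.
have notneither : ~ (~ Omega (S 1) /\ ~ Omega (S (-1))).
  move=> [in1 Om1].
  have [|z [inz]] := @Omega_regular (g t0) (@curve_in_Omega t0) (~` interior Omega).
    apply: decomp; first exact: curve_notin_interior.
    move=> b t s b1 te se /subO; have [[/subO + _]|[_ //]] := sideE b t s b1 te se.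
    by case: b1 => ->.
  exact.
have key b : b = 1 \/ b = -1 -> Omega (S b) -> ~ Omega (S (- b)) ->
    forall t, `|t - t0| < e -> inward b t e.
  move=> b1 OS nOS t te s se; split.
    by have [[]//|[]//] := sideE b t s b1 te se.
  rewrite -scaleNr -mulrN.
  have b1' : - b = 1 \/ - b = -1 by case: b1 => ->; rewrite ?opprK; [right|left].
  by have [[/subO]//|[]//] := sideE (- b) t s b1' te se.
have [in1|in1] := pselect (Omega (S 1)).
  exists 1; [by left|apply: key => //; first by left].
  by move=> Om1; apply: notboth.
exists (-1); [by right|apply: key; first by right].
  by apply: contrapT => Om1; apply: notneither.
by rewrite opprK.
Qed.

(** The parameters near which a given sign works form an open set. The sets for 1 and -1 are
    disjoint and cover the line, which is connected. *)
Lemma inward_side : exists2 k : R, k = 1 \/ k = -1 &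
  forall t0 : R, exists2 e : R, 0 < e & forall t, `|t - t0| < e -> inward k t e.
Proof.
pose A (k : R) := [set t0 : R | exists2 e : R, 0 < e & forall t, `|t - t0| < e -> inward k t e].
have oA k : open (A k).
  rewrite openE => t0 [e e0 He]; apply/nbhs_ballP; exists (e / 2) => /=; first by rewrite divr_gt0.
  move=> t1; rewrite /ball /= distrC => t1e; exists (e / 2); first by rewrite divr_gt0.
  move=> t te s /andP[s0 se]; apply: He; last by rewrite s0 /=; lra.
  rewrite (_ : t - t0 = (t - t1) + (t1 - t0)); last by ring.
  by apply: le_lt_trans (ler_normD _ _) _; lra.
have A12 : A 1 `|` A (-1) = setT.
  apply/seteqP; split=> // t _; have [e e0 [k [->|->] He]] := local_sides t; [left|right]; by exists e.
have disj : A 1 `&` A (-1) = set0.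
  apply/seteqP; split=> // t [[e e0 He] [e' e'0 He']].
  have [h0 he he'] : [/\ 0 < Num.min e e' / 2, Num.min e e' / 2 < e & Num.min e e' / 2 < e'].
    have : 0 < Num.min e e' by rewrite lt_min e0.
    have : Num.min e e' <= e by rewrite ge_min lexx.
    have : Num.min e e' <= e' by rewrite ge_min lexx orbT.
    by move=> *; split; lra.
  have tt (c : R) : 0 < c -> `|t - t| < c by rewrite subrr normr0.
  have [|/interior_subset in1 _] := He t (tt _ e0) (Num.min e e' / 2); first by rewrite h0.
  have [|_] := He' t (tt _ e'0) (Num.min e e' / 2); first by rewrite h0.
  by rewrite -scaleNr mulrN1 opprK -(mulr1 (_ / _)).
have cT : connected (@setT R) by apply/connected_intervalP => ? ? ? ? ? ?.
have [A1|nA1] := pselect (A 1 !=set0).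
  exists 1; [by left|move=> t].
  suff : A 1 t by [].
  rewrite (_ : A 1 = setT)//; apply: cT => //.
    by exists (A 1) => //; rewrite setTI.
  exists (~` A (-1)); first exact: open_closedC.
  rewrite setTI; apply/seteqP; split=> s.
    by move=> s1 s2; have : (A 1 `&` A (-1)) s by []; rewrite disj.
  move=> s2; have : (A 1 `|` A (-1)) s by rewrite A12.
  by case.
exists (-1); [by right|move=> t]; have : (A 1 `|` A (-1)) t by rewrite A12.
by case=> // A1t; exfalso; apply: nA1; exists t.
Qed.
End Curve.

(** * Chords of the enclosed region *)

(* [w] is the inner unit direction of the rules along the boundary curve. *)
Section Chords.
Variables (R : realType) (g w : R -> plane R) (L : R) (Omega : set (plane R)).
Hypothesis L_gt0 : 0 < L.
Hypothesis g_inj : forall s t, g s = g t <-> exists k : int, t = s + k%:~R * L.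
Hypothesis g_cont : continuous g.
Hypothesis w_cont : continuous w.
Hypothesis w_unit : forall t, dot (w t) (w t) = 1.
Hypothesis Omega_compact : compact Omega.
Hypothesis Omega_boundary : boundary Omega = range g.
Hypothesis w_inward : forall t0 : R, exists2 e : R, 0 < e &
  forall t, `|t - t0| < e -> forall s, 0 < s < e ->
    interior Omega (g t + s *: w t) /\ ~ Omega (g t - s *: w t).

Definition seg_in (t s : R) := forall r, 0 <= r <= s -> Omega (g t + r *: w t).

Hypothesis w_rule : forall t s t', 0 < s -> seg_in t s ->
  g t' = g t + s *: w t -> w t' = w t \/ w t' = - w t.

Definition is_chord (t s : R) :=
  [/\ 0 < s, seg_in t s & range g (g t + s *: w t)].

Let Omega_closed : closed Omega.
Proof. by apply: compact_closed => //; exact: norm_hausdorff. Qed.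

Lemma inward_at t : exists2 e : R, 0 < e & forall s, 0 < s < e ->
    interior Omega (g t + s *: w t) /\ ~ Omega (g t - s *: w t).
Proof.
have [e e0 He] := w_inward t; exists e => // s; apply: He.
by rewrite subrr normr0.
Qed.

(** If the inner direction at the end were still [w t], stepping back along the segment would mean
    stepping outwards at [t'], although the segment lies in [Omega]. *)
Lemma chord_end (t s t' : R) : 0 < s -> seg_in t s -> g t' = g t + s *: w t ->
  w t' = - w t.
Proof.
move=> s0 ts gt'; have [wt'|//] := w_rule s0 ts gt'; exfalso.
have [e e0 He] := inward_at t'.
have [h0 [hs he]] : 0 < Num.min s e / 2 /\ Num.min s e / 2 <= s /\ Num.min s e / 2 < e.
  have : 0 < Num.min s e by rewrite lt_min s0.
  have : Num.min s e <= s by rewrite ge_min lexx.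
  have : Num.min s e <= e by rewrite ge_min lexx orbT.
  by move=> *; do !split; lra.
have [|_] := He (Num.min s e / 2); first by rewrite h0.
rewrite wt' gt' -addrA -scalerBl; apply; apply: ts; apply/andP; split; lra.
Qed.

(** At a boundary point inside the segment the inner direction would be [- w t] by [chord_end], so
    the rest of the segment would leave [Omega] at once. *)
Lemma chord_interior (t s r : R) : seg_in t s -> 0 < r < s ->
  ~ range g (g t + r *: w t).
Proof.
move=> ts /andP[r0 rs] [t' _ gt'].
have wt' : w t' = - w t.
  by apply: (chord_end r0 _ gt') => q /andP[q0 qr]; apply: ts; rewrite q0 /=; lra.
have [e e0 He] := inward_at t'.
have [h0 [hs he]] : 0 < Num.min (s - r) e / 2 /\ Num.min (s - r) e / 2 <= s - r
    /\ Num.min (s - r) e / 2 < e.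
  have : 0 < Num.min (s - r) e by rewrite lt_min e0 andbT; lra.
  have : Num.min (s - r) e <= s - r by rewrite ge_min lexx.
  have : Num.min (s - r) e <= e by rewrite ge_min lexx orbT.
  by move=> *; do !split; lra.
have [|_] := He (Num.min (s - r) e / 2); first by rewrite h0.
rewrite wt' gt' scalerN opprK -addrA -scalerDl; apply; apply: ts; apply/andP; split; lra.
Qed.

Lemma chord_uniq (t s s' : R) : is_chord t s -> is_chord t s' -> s = s'.
Proof.
move=> [s0 ts gs] [s'0 ts' gs']; have [ss'|ss'|//] := ltgtP s s'; exfalso.
  by apply: (chord_interior ts' _ gs); rewrite s0.
by apply: (chord_interior ts _ gs'); rewrite s'0.
Qed.

Lemma line_cont (a b : plane R) : continuous (fun s : R => a + s *: b).
Proof.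
move=> s; apply: cvgD; first exact: cvg_cst.
by apply: cvgZ; [exact: cvg_id|exact: cvg_cst].
Qed.

Lemma line_meets_boundary (a b : plane R) (p q : R) : p <= q ->
  interior Omega (a + p *: b) -> ~ interior Omega (a + q *: b) ->
  exists2 s, p <= s <= q & boundary Omega (a + s *: b).
Proof.
move=> pq ip nq; apply: contrapT => nb.
have [||[_ iq]|[np _]] := @path_side R Omega (fun l => a + (p + l * (q - p)) *: b) Omega_closed.
- move=> l; apply: cvgD; first exact: cvg_cst.
  apply: cvgZ; last exact: cvg_cst.
  apply: cvgD; first exact: cvg_cst.
  by apply: cvgM; [exact: cvg_id|exact: cvg_cst].
- move=> l /andP[l0 l1] bl; apply: nb; exists (p + l * (q - p)) => //.
  by apply/andP; split; nra.
- by apply: nq; move: iq; rewrite mul1r (addrC p) subrK.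
- by apply: np; rewrite mul0r addr0; exact: interior_subset.
Qed.

(** The inner product with [b] is bounded on the compact [Omega] but not along the line. *)
Lemma line_leaves (a b : plane R) (q : R) : dot b b = 1 ->
  exists2 s, q <= s & ~ Omega (a + s *: b).
Proof.
move=> b1; apply: contrapT => nex.
have inO s : q <= s -> Omega (a + s *: b).
  by move=> qs; apply: contrapT => nO; apply: nex; exists s.
pose D := (fun z => dot z b) @` Omega.
have cD : compact D.
  apply: continuous_compact => //; apply: continuous_subspaceT => z.
  by apply: cvg_dot; [exact: cvg_id|exact: cvg_cst].
have Dq : D (dot (a + q *: b) b) by exists (a + q *: b) => //; exact: inO.
have [_ [M DM]] : has_sup D by apply: compact_has_sup => //; exists (dot (a + q *: b) b).
have qM : q <= M - dot a b.
  by have := DM _ Dq; rewrite dotDl dotZl b1 mulr1; lra.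
have := DM (dot (a + (M - dot a b + 1) *: b) b).
rewrite dotDl dotZl b1 mulr1 => h.
have : dot a b + (M - dot a b + 1) <= M.
  apply: h; exists (a + (M - dot a b + 1) *: b); first by apply: inO; lra.
  by rewrite dotDl dotZl b1 mulr1.
lra.
Qed.

Lemma chord_exists t : exists s, is_chord t s.
Proof.
have [e e0 He] := inward_at t.
have He1 r : 0 < r < e -> interior Omega (g t + r *: w t) by move=> /He[].
have e2 : 0 < e / 2 < e by apply/andP; split; lra.
have [M eM nM] := line_leaves (g t) (e / 2) (w_unit t).
(* The chord will end at the least element of [K]. The search starts at [e / 2], where the line is
   inside, because the starting point of the line is itself on the boundary. *)
pose K := `[e / 2, M] `&` ((fun s => g t + s *: w t) @^-1` boundary Omega).
have cK : compact K.
  apply: compact_closedI; first exact: segment_compact.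
  apply: (continuous_closedP _).1; first exact: line_cont.
  by apply: closedI; [exact: closed_closure|apply: open_closedC; exact: open_interior].
have K0 : K !=set0.
  have [|s /andP[s1 s2] bs] := line_meets_boundary eM (He1 _ e2).
    by move=> /interior_subset.
  by exists s; split => //=; rewrite in_itv /= s1.
have [|s0 + smin] := @compact_EVT_min _ R id K K0 cK.
  by apply: continuous_subspaceT => x; exact: cvg_id.
rewrite inE => -[/=]; rewrite in_itv /= => /andP[es sM] bs.
have s00 : 0 < s0 by case/andP: e2 => ? ?; lra.
exists s0; split => //; last by rewrite -Omega_boundary.
move=> r /andP[]; rewrite le_eqVlt => /predU1P[<- _|r0].
  by rewrite scale0r addr0; exact: (curve_in_Omega Omega_closed Omega_boundary).
rewrite le_eqVlt => /predU1P[->|rs].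
  by case: bs => + _; rewrite -(closure_id Omega).1.
have [re|er] := ltP r e; first by apply: interior_subset; apply: He1; rewrite r0.
(* An excursion outside [Omega] before [s0] would produce an earlier boundary point. *)
apply: contrapT => nr.
have er2 : e / 2 <= r by case/andP: e2 => ? ?; lra.
have [|s' /andP[s1 s2] bs'] := line_meets_boundary er2 (He1 _ e2).
  by move=> /interior_subset.
have : s0 <= s'.
  by apply: smin; rewrite inE; split => //=; rewrite in_itv /= s1 /=; lra.
lra.
Qed.

(** Among the many parameters of the other end point, the one in the period after [t] is selected,
    so that exchanging end points becomes a map of the line rather than of the circle. *)
Definition chord_to (t p : R) :=
  t < p < t + L /\ exists s, is_chord t s /\ g p = g t + s *: w t.

Lemma chord_to_exists t : exists p, chord_to t p.
Proof.
have [s cs] := chord_exists t; have [s0 _ [p0 _ gp0]] := cs.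
have [k /andP[k1 k2]] := shift_into t p0 L_gt0.
have gp : g (p0 + k%:~R * L) = g t + s *: w t.
  by rewrite -gp0; apply/esym/g_inj; exists k.
exists (p0 + k%:~R * L); split; last by exists s.
rewrite k2 andbT lt_neqAle k1 andbT; apply/eqP => tp; move: gp; rewrite -tp.
rewrite -[LHS]addr0 => /addrI/(congr1 (fun a => dot a (w t))).
by rewrite dotZl w_unit mulr1 /dot /= !mul0r addr0 => s0'; rewrite -s0' ltxx in s0.
Qed.

Lemma chord_to_uniq t p p' : chord_to t p -> chord_to t p' -> p = p'.
Proof.
move=> [/andP[tp pL] [s [cs gp]]] [/andP[tp' pL'] [s' [cs' gp']]].
have : g p = g p' by rewrite gp gp' (chord_uniq cs cs').
move=> /g_inj[k pk]; rewrite pk (@int_small R k) ?mul0r ?addr0//.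
rewrite -(ltr_pM2r L_gt0) mul1r -[X in _ * X]gtr0_norm// -normrM ltr_norml.
by have L0 := L_gt0; apply/andP; split; lra.
Qed.

(** Traversed backwards, the chord ends at [g t], whose parameter in the period after [p] is [t + L]
    and not [t]. *)
Lemma chord_to_sym t p : chord_to t p -> chord_to p (t + L).
Proof.
move=> [/andP[tp pL] [s [[s0 ts gs] gp]]].
have wp : w p = - w t := chord_end s0 ts gp.
have gt : g (t + L) = g p + s *: w p.
  rewrite wp gp scalerN addrK; apply/esym/g_inj; exists 1.
  by rewrite mul1r.
split; first by apply/andP; split; lra.
exists s; split => //; split => //; last by rewrite -gt; exists (t + L).
move=> r /andP[r0 rs]; rewrite wp gp scalerN -addrA -scalerBl; apply: ts.
by apply/andP; split; lra.
Qed.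

(* A closed condition on (t, p), equivalent to [chord_to t p] near a point
   where [e] bounds below the length of the chords. *)
Definition chord_graph (e : R) : set (R * R) := [set x : R * R |
  [/\ 0 <= x.2 - x.1, x.2 - x.1 <= L,
      e <= dot (g x.2 - g x.1) (w x.1), cross (w x.1) (g x.2 - g x.1) = 0 &
      forall l, 0 <= l <= 1 -> Omega (g x.1 + l *: (g x.2 - g x.1))]].

Lemma chord_graph_closed e : closed (chord_graph e).
Proof.
have c1 (f : R -> plane R) : continuous f -> continuous (fun x : R * R => f x.1).
  by move=> cf x; apply: (cvg_comp fst f _ (cf x.1)); exact: cvg_fst.
have c2 (f : R -> plane R) : continuous f -> continuous (fun x : R * R => f x.2).
  by move=> cf x; apply: (cvg_comp snd f _ (cf x.2)); exact: cvg_snd.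
have dif : continuous (fun x : R * R => x.2 - x.1).
  by move=> x; apply: cvgB; [exact: cvg_snd|exact: cvg_fst].
have gdif : continuous (fun x : R * R => g x.2 - g x.1).
  by move=> x; apply: cvgB; [exact: c2|exact: c1].
rewrite (_ : chord_graph e =
  ((fun x : R * R => x.2 - x.1) @^-1` [set y | 0 <= y]) `&`
  (((fun x : R * R => x.2 - x.1) @^-1` [set y | y <= L]) `&`
  (((fun x : R * R => dot (g x.2 - g x.1) (w x.1)) @^-1` [set y | e <= y]) `&`
  (((fun x : R * R => cross (w x.1) (g x.2 - g x.1)) @^-1` [set y | y = 0]) `&`
  \bigcap_(l in [set l : R | 0 <= l <= 1])
    ((fun x : R * R => g x.1 + l *: (g x.2 - g x.1)) @^-1` Omega))))); last first.
  by apply/seteqP; split=> x /=; [move=> [? ? ? ? H]; do !split|move=> [? [? [? [? H]]]]; split].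
apply: closedI; first by apply: (continuous_closedP _).1 => //; exact: closed_ge.
apply: closedI; first by apply: (continuous_closedP _).1 => //; exact: closed_le.
apply: closedI.
  apply: (continuous_closedP _).1; last exact: closed_ge.
  by move=> x; apply: cvg_dot; [exact: gdif|exact: c1].
apply: closedI.
  apply: (continuous_closedP _).1; last exact: closed_eq.
  by move=> x; apply: cvg_cross; [exact: c1|exact: gdif].
apply: closed_bigI => l _; apply: (continuous_closedP _).1 => // x.
apply: cvgD; first exact: c1.
by apply: cvgZ; [exact: cvg_cst|exact: gdif].
Qed.

(** The positive lower bound on the length keeps the two ends apart, which makes the weak
    inequalities between [t], [p] and [t + L] strict. *)
Lemma chord_graph_sub e t p : 0 < e -> chord_graph e (t, p) -> chord_to t p.
Proof.
move=> e0 [/= tp pL ed c0 inO].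
have gp : g p = g t + dot (g p - g t) (w t) *: w t.
  by rewrite -(cross0_unit (w_unit t) c0) addrC subrK.
have s0 : 0 < dot (g p - g t) (w t) by exact: lt_le_trans ed.
have gtp : g t != g p.
  by apply/eqP => gtp; move: s0; rewrite gtp subrr /dot /= !mul0r addr0 ltxx.
split.
  have tp0 : t != p by apply: contraNneq gtp => ->.
  have tpL : p != t + L.
    by apply: contraNneq gtp => ->; apply/eqP/g_inj; exists 1; rewrite mul1r.
  by rewrite !lt_neqAle tp0 tpL /=; apply/andP; split; lra.
exists (dot (g p - g t) (w t)); split => //; split => //; last by exists p.
move=> r /andP[r0 rs].
move: s0 rs (cross0_unit (w_unit t) c0) (inO (r / dot (g p - g t) (w t))).
move: (dot _ _) => D D0 rD ->; rewrite scalerA divfK ?gt_eqF//.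
by apply; rewrite divr_ge0 ?(ltW D0)//= ler_pdivrMr// mul1r.
Qed.

(** A chord shorter than [e] would end at an interior point by [w_inward], and not on the
    boundary. *)
Lemma chord_length_near t0 : exists2 e : R, 0 < e &
  forall t p, `|t - t0| < e -> chord_to t p -> chord_graph e (t, p).
Proof.
have [e e0 He] := w_inward t0; exists e => // t p te.
move=> [/andP[tp pL] [s [[s0 ts gs] gp]]].
have gpt : g p - g t = s *: w t by rewrite gp addrAC subrr add0r.
split => /=; rewrite ?gpt ?crossZr ?crossxx ?dotZl ?w_unit ?mulr0 ?mulr1//.
- by lra.
- by lra.
- rewrite leNgt; apply/negP => se.
  have [|+ _] := He t te s; first by rewrite s0.
  by rewrite -gp; exact: (curve_notin_interior Omega_boundary).
- move=> l /andP[l0 l1]; rewrite scalerA; apply: ts.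
  by apply/andP; split; nra.
Qed.

(** Continuity follows from a closed graph and a compact range, injectivity from
    [phi (phi t) = t + L]. A continuous injection of the line is monotone. *)
Lemma chord_map : exists phi : R -> R,
  [/\ forall t, chord_to t (phi t), continuous phi &
      forall s t, s < t -> phi s < phi t].
Proof.
have [phi Hphi] := choice chord_to_exists.
have phi2 t : phi (phi t) = t + L.
  by apply: chord_to_uniq (chord_to_sym (Hphi t)).
have cphi : continuous phi.
  move=> t0; apply/cvgrPdist_lt => eps eps0.
  have [e e0 He] := chord_length_near t0.
  (* For [t] within 1 of [t0], the value [phi t] lies between [t] and [t + L], hence in this window;
     [K] holds the values to be excluded. *)
  pose K : set R := `[t0 - 1, t0 + 1 + L] `&` ~` ball (phi t0) eps.
  have cK : compact K.
    apply: compact_closedI; first exact: segment_compact.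
    by apply: open_closedC; exact: ball_open.
  have : \forall t \near t0, K `<=` (fun p => ~ chord_graph e (t, p)).
    apply: ((compact_near_coveringP K).1 cK _ (nbhs t0)
      (fun t p => ~ chord_graph e (t, p))) => p [_ pe].
    have : nbhs (t0, p) (~` chord_graph e).
      apply: open_nbhs_nbhs; split; first exact/closed_openC/chord_graph_closed.
      move=> /(chord_graph_sub e0)/(chord_to_uniq (Hphi t0)) pt; apply: pe.
      by rewrite -pt; exact: ballxx.
    move=> /nbhs_ballP[d /= d0 Hd]; exists (ball p d, ball t0 d).
      by split; exact: nbhsx_ballx.
    move=> x [/= x1 x2].
    by apply: (Hd (x.2, x.1)).
  move=> nearK; near=> t.
  have te : `|t - t0| < Num.min 1 e.
    by near: t; apply/nbhs_ballP; exists (Num.min 1 e) => /=;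
      [rewrite lt_min e0 ltr01|move=> t; rewrite /ball /= distrC].
  move: te; rewrite lt_min => /andP[t1 te].
  rewrite ltNge; apply/negP => nt.
  have /(_ (phi t)) : K `<=` (fun p => ~ chord_graph e (t, p)) by near: t.
  apply; last exact: He.
  split; last by rewrite /ball /=; apply/negP; rewrite -leNgt.
  have [/andP[h1 h2] _] := Hphi t.
  move: t1; rewrite ltr_norml => /andP[t1 t2].
  by rewrite /= in_itv /=; apply/andP; split; lra.
exists phi; split => //.
have L0 := L_gt0.
have phi_inj : {in `]-oo, +oo[ &, injective phi}.
  by move=> s t _ _ st; have := phi2 s; rewrite st phi2 => /addIr.
have [mono|mono] := @itv_continuous_inj_mono R phi `]-oo, +oo[
   (continuous_subspaceT cphi) phi_inj.
  by move=> s t st; rewrite mono// in_itv.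
(* As [0 < phi 0], a decreasing [phi] would give [phi (phi 0) < phi 0], but [phi (phi 0)] is [L],
   which exceeds [phi 0]. *)
exfalso.
have [/andP[h1 h2] _] := Hphi 0; have [/andP[h3 h4] _] := Hphi (phi 0).
have : phi (phi 0) < phi 0 by rewrite mono ?in_itv.
by rewrite phi2; lra.
Unshelve. all: by end_near. Qed.

(** * Crossing chords and the heights of the surface over them *)

Variable k : R.
Hypothesis w_arc : forall t0 : R, exists2 e : R, 0 < e &
  forall a s t, `|a - t0| < e -> `|s - t0| < e -> `|t - t0| < e -> s < t ->
    0 < k * cross (w a) (g t - g s).
Variable u : plane R -> R.
Hypothesis w_lift : forall t s r, seg_in t s -> 0 <= r <= s ->
  u (g t + r *: w t) = u (g t) + r * (cross (g t) (w t) / 2).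

Definition on_chord (t : R) (X : plane R) :=
  exists2 r : R, 0 <= r & seg_in t r /\ X = g t + r *: w t.

(** Height is affine along a chord with slope [cross (g t) (w t) / 2], and [cross X Y] is
    [cross (g t) (w t)] times the difference of the two parameters. *)
Lemma on_chord_lift t X Y : on_chord t X -> on_chord t Y ->
  u Y - u X = cross X Y / 2.
Proof.
move=> [r r0 [tr ->]] [q q0 [tq ->]].
rewrite (@w_lift t r r) ?r0 ?lexx// (@w_lift t q q) ?q0 ?lexx//.
by rewrite /cross /= /GRing.scale /=; field.
Qed.

Lemma curve_on_chord t : on_chord t (g t).
Proof.
exists 0 => //; split; last by rewrite scale0r addr0.
move=> r; rewrite -eq_le => /eqP <-; rewrite scale0r addr0.
exact: (curve_in_Omega Omega_closed Omega_boundary).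
Qed.

Lemma cross_basis (a b z : plane R) : cross a b != 0 ->
  z = (cross z b / cross a b) *: a + (cross a z / cross a b) *: b.
Proof.
case: a b z => [a1 a2] [b1 b2] [z1 z2]; rewrite /cross /= => d0.
by congr pair; rewrite /= /GRing.scale /=; field.
Qed.

(* The two end points of each chord lie on opposite sides of the other chord:
   the inner directions at the two ends of a chord are opposite, while the end
   points of nearby chords are ordered in the same way at both ends. *)
Lemma near_chords_cross : exists2 e : R, 0 < e & forall s t,
  `|s| < e -> `|t| < e -> s < t -> cross (w s) (w t) != 0 /\
    exists2 X, on_chord s X & on_chord t X.
Proof.
have [phi [Hphi cphi phi_incr]] := chord_map.
have [e0 e00 He0] := w_arc 0.
have [e1 e10 He1] := w_arc (phi 0).
have /cvgrPdist_lt/(_ _ e10)/nbhs_ballP[e2 /= e20 He2] := cphi 0.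
exists (Num.min e0 e2); first by rewrite lt_min e00.
move=> s t; rewrite !lt_min => /andP[s0 s2] /andP[t0 t2] st.
have phi_near r : `|r| < e2 -> `|phi r - phi 0| < e1.
  by move=> re; rewrite distrC; apply: He2; rewrite /ball /= sub0r normrN.
have [_ [l [[l0 sl _] gs']]] := Hphi s.
have [_ [m [[m0 tm _] gt']]] := Hphi t.
have ws' := chord_end l0 sl gs'.
have wt' := chord_end m0 tm gt'.
have near0 (r : R) : `|r| < e0 -> `|r - 0| < e0 by rewrite subr0.
have a1 := He0 s s t (near0 _ s0) (near0 _ s0) (near0 _ t0) st.
have a2 := He0 t s t (near0 _ t0) (near0 _ s0) (near0 _ t0) st.
have b1 := He1 (phi s) _ _ (phi_near _ s2) (phi_near _ s2) (phi_near _ t2) (phi_incr _ _ st).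
have b2 := He1 (phi t) _ _ (phi_near _ t2) (phi_near _ s2) (phi_near _ t2) (phi_incr _ _ st).
move: b1 b2; rewrite ws' wt' gs' gt' !crossNl !crossBr !crossDr !crossZr !crossxx.
move: a1 a2; rewrite !crossBr (crossC (w t) (w s)) => a1 a2 b1 b2.
set D := cross (w s) (w t) in b1 b2 *.
(* Adding [a1] and [b1] cancels the terms in [g t - g s] and leaves [m * (k * D) < 0]. *)
have kD : k * D < 0.
  have : m * (k * D) < 0 by lra.
  by rewrite pmulr_rlt0.
have D0 : D != 0 by apply: contraTneq kD => ->; rewrite mulr0 ltxx.
split=> //.
pose z := g t - g s.
have zE := cross_basis z D0; rewrite -/D in zE.
(* By Cramer's rule [z] is [r *: w s - q *: w t], so the two lines meet at parameter [r] on the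
   first and [q] on the second. *)
pose r := cross z (w t) / D; pose q := - (cross (w s) z / D).
have rkD : r * (k * D) = - (k * (cross (w t) (g t) - cross (w t) (g s))).
  by rewrite /r (crossC z) /z crossBr; field.
have qkD : q * (k * D) = - (k * (cross (w s) (g t) - cross (w s) (g s))).
  by rewrite /q /z crossBr; field.
have itv (x y : R) : x * (k * D) < 0 -> y * (k * D) < x * (k * D) -> 0 < x < y.
  by move=> h1 h2; rewrite -(nmulr_llt0 _ kD) h1 /= -(ltr_nM2r kD).
(* Here [a2] and [b2] place [r] between 0 and [l]; on the next line [a1] and [b1] place [q] between
   0 and [m]. *)
have /andP[r0 rl] : 0 < r < l by apply: itv; rewrite rkD; lra.
have /andP[q0 qm] : 0 < q < m by apply: itv; rewrite qkD; lra.
exists (g s + r *: w s).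
  exists r; [exact: ltW|split=> // x /andP[x0 xr]; apply: sl].
  by rewrite x0 /=; lra.
exists q; [exact: ltW|split=> [x /andP[x0 xr]|]].
  by apply: tm; rewrite x0 /=; lra.
have -> : g t = g s + z by rewrite /z addrC subrK.
by rewrite [X in _ + X + _]zE -!addrA -scalerDl /q addrN scale0r addr0.
Qed.

Lemma arc_in_plane : exists2 e : R, 0 < e & exists X : plane R,
  forall t, `|t| < e -> u (g t) - u X = cross X (g t) / 2.
Proof.
have [e e0 He] := near_chords_cross; exists e => //.
have cross_neq s t : `|s| < e -> `|t| < e -> s != t ->
    cross (w s) (w t) != 0 /\ exists2 X, on_chord s X & on_chord t X.
  move=> se te; rewrite neq_lt => /orP[st|ts]; first exact: He.
  have [c [X Xt Xs]] := He t s te se ts.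
  by split; [rewrite crossC oppr_eq0|exists X].
have e2 : `|e / 2| < e by rewrite gtr0_norm; lra.
have ne2 : `|- (e / 2)| < e by rewrite normrN.
have [ab [X Xa Xb]] : cross (w (- (e / 2))) (w (e / 2)) != 0 /\
    exists2 X, on_chord (- (e / 2)) X & on_chord (e / 2) X.
  by apply: He => //; lra.
move: e2 ne2 ab Xa Xb; move: (- (e / 2)) => a; move: (e / 2) => b be ae ab Xa Xb.
exists X => t te; apply: on_chord_lift (curve_on_chord t).
have [->//|ta] := eqVneq t a; have [->//|tb] := eqVneq t b.
have [_ [Y Yt Ya]] := cross_neq _ _ te ae ta.
have [_ [Z Zt Zb]] := cross_neq _ _ te be tb.
have h1 := on_chord_lift Xa Ya; have h2 := on_chord_lift Xb Zb.
have h3 := on_chord_lift Yt Zt.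
(* The height differences around the triangle add up to 0, so [cross X Y + cross Y Z + cross Z X],
   twice its signed area, vanishes. *)
have YZ : cross (Y - X) (Z - X) = 0.
  rewrite crossBr (crossC _ Z) (crossC _ X) !crossBr crossxx (crossC Z Y) (crossC Z X).
  by move: h1 h2 h3; lra.
have [r YX] : exists r, Y - X = r *: w a.
  move: Xa Ya => [r1 _ [_ ->]] [r2 _ [_ ->]]; exists (r2 - r1).
  by rewrite opprD addrACA subrr add0r scalerBl.
have [q ZX] : exists q, Z - X = q *: w b.
  move: Xb Zb => [r1 _ [_ ->]] [r2 _ [_ ->]]; exists (r2 - r1).
  by rewrite opprD addrACA subrr add0r scalerBl.
(* The two fixed chords are not parallel, so [Y] or [Z] equals [X]; either way the chord from [t]
   passes through [X]. *)
move: YZ; rewrite YX ZX crossZl crossZr => /eqP; rewrite !mulf_eq0 (negbTE ab) orbF.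
move=> /orP[/eqP r0|/eqP q0].
  by move: YX; rewrite r0 scale0r => /subr0_eq <-.
by move: ZX; rewrite q0 scale0r => /subr0_eq <-.
Qed.

End Chords.

(** * Rules of the surface *)

Section Surface.
Variable R : realType.

Lemma is_derive_fst (V1 V2 : normedModType R) (f : R -> V1 * V2) (t : R) :
  derivable f t 1 -> is_derive t 1 (fun s => (f s).1) ('D_1 f t).1.
Proof.
move=> df.
have h : (fun h : R => h^-1 *: ((f (h *: 1 + t)).1 - (f t).1)) @ 0^' --> ('D_1 f t).1.
  by apply: (cvg_comp (fun h : R => h^-1 *: (f (h *: 1 + t) - f t)) fst df); exact: cvg_fst.
split; first exact: cvgP h.
exact: cvg_lim h.
Qed.

Lemma is_derive_snd (V1 V2 : normedModType R) (f : R -> V1 * V2) (t : R) :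
  derivable f t 1 -> is_derive t 1 (fun s => (f s).2) ('D_1 f t).2.
Proof.
move=> df.
have h : (fun h : R => h^-1 *: ((f (h *: 1 + t)).2 - (f t).2)) @ 0^' --> ('D_1 f t).2.
  by apply: (cvg_comp (fun h : R => h^-1 *: (f (h *: 1 + t) - f t)) snd df); exact: cvg_snd.
split; first exact: cvgP h.
exact: cvg_lim h.
Qed.

Lemma derive_plane (u : plane R -> R) (z v : plane R) : differentiable u z ->
  'D_v u z = v.1 * dx u z + v.2 * dy u z.
Proof.
move=> du; rewrite /dx /dy !deriveE//.
have {1}-> : v = v.1 *: ((1, 0) : plane R) + v.2 *: ((0, 1) : plane R).
  by case: v => v1 v2; congr pair; rewrite /= /GRing.scale /=; ring.
by rewrite linearD !linearZ.
Qed.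

Lemma snd_differentiable (a : heis R) : differentiable (snd : heis R -> R) a.
Proof. by apply: linear_differentiable => b; exact: cvg_snd. Qed.

Lemma gpE (u : plane R -> R) (z : plane R) : differentiable u z ->
  gp u z = - (z.2 / 2) - dx u z.
Proof.
move=> du; rewrite /gp.
have -> : (fun a : heis R => a.2 - u a.1) = (snd : heis R -> R) - (u \o fst : heis R -> R) by [].
have d1 : derivable (snd : heis R -> R) (Defs.lift u z) (X1 (Defs.lift u z)).
  exact/diff_derivable/snd_differentiable.
have d2 : derivable (u \o fst : heis R -> R) (Defs.lift u z) (X1 (Defs.lift u z)).
  exact: (@diff_derivable _ _ _ u z _ du).
rewrite deriveB//; congr (_ - _).
rewrite deriveE; last exact: snd_differentiable.
by rewrite diff_lin// => a; exact: cvg_snd.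
Qed.

Lemma gqE (u : plane R -> R) (z : plane R) : differentiable u z ->
  gq u z = z.1 / 2 - dy u z.
Proof.
move=> du; rewrite /gq.
have -> : (fun a : heis R => a.2 - u a.1) = (snd : heis R -> R) - (u \o fst : heis R -> R) by [].
have d1 : derivable (snd : heis R -> R) (Defs.lift u z) (X2 (Defs.lift u z)).
  exact/diff_derivable/snd_differentiable.
have d2 : derivable (u \o fst : heis R -> R) (Defs.lift u z) (X2 (Defs.lift u z)).
  exact: (@diff_derivable _ _ _ u z _ du).
rewrite deriveB//; congr (_ - _).
rewrite deriveE; last exact: snd_differentiable.
by rewrite diff_lin// => a; exact: cvg_snd.
Qed.

Lemma same_sign (f : R -> R) : continuous f -> (forall t, f t != 0) ->
  exists2 k : R, k = 1 \/ k = -1 & forall t, 0 < k * f t.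
Proof.
move=> cf f0.
have key (s t : R) : s <= t -> 0 < f s * f t.
  move=> st; rewrite lt_neqAle eq_sym mulf_neq0//= leNgt; apply/negP => neg.
  have [||x _ fx0] := @IVT R f s t 0 st; first exact: continuous_subspaceT.
    rewrite ge_min le_max.
    by have [s0|s0|s0] := ltgtP (f s) 0; have [t0|t0|t0] := ltgtP (f t) 0 => //; nra.
  by have := f0 x; rewrite fx0 eqxx.
have sgn0 t : 0 < f 0 * f t.
  by have [t0|t0] := leP 0 t; [exact: key|rewrite mulrC; apply: key; exact: ltW].
have [f00|f00|f00] := ltgtP (f 0) 0; last by have := f0 0; rewrite f00 eqxx.
  exists (-1); first by right.
  by move=> t; have := sgn0 t; rewrite mulN1r nmulr_rgt0// oppr_gt0.
by exists 1; [left|move=> t; have := sgn0 t; rewrite mul1r pmulr_rgt0].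
Qed.

Variables (u : plane R -> R) (Omega : set (plane R)).
Hypothesis u_C1 : C1_graph Omega u.
Hypothesis u_ruled : ruled_off_char_locus Omega u.
Hypothesis u_extend : rules_extend Omega u.

Lemma u_differentiable z : Omega z -> differentiable u z.
Proof. by case: u_C1 => W [_ OW [du _ _]] /OW; exact: du. Qed.

(** The formula of [gpE] holds on an open set [W] containing [Omega], so continuity of the partial
    derivative transfers at boundary points too. *)
Lemma gp_continuous z : Omega z -> {for z, continuous (gp u)}.
Proof.
case: u_C1 => W [oW OW [du cdx _]] /OW Wz.
have nE : {near z, (fun z : plane R => - (z.2 / 2) - dx u z) =1 gp u}.
  by apply: filterS (open_nbhs_nbhs (conj oW Wz)) => y /du /gpE ->.
have := near_eq_cvg nE; rewrite /continuous_at => E.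
apply: cvg_trans; first exact: E.
rewrite gpE; last exact: du.
apply: cvgB; last exact: cdx.
by apply: cvgN; apply: cvgM; [exact: cvg_snd|exact: cvg_cst].
Qed.

Lemma gq_continuous z : Omega z -> {for z, continuous (gq u)}.
Proof.
case: u_C1 => W [oW OW [du _ cdy]] /OW Wz.
have nE : {near z, (fun z : plane R => z.1 / 2 - dy u z) =1 gq u}.
  by apply: filterS (open_nbhs_nbhs (conj oW Wz)) => y /du /gqE ->.
have := near_eq_cvg nE; rewrite /continuous_at => E.
apply: cvg_trans; first exact: E.
rewrite gqE; last exact: du.
apply: cvgB; last exact: cdy.
by apply: cvgM; [exact: cvg_fst|exact: cvg_cst].
Qed.

(** The last component of the horizontal vector over [d] at [z] is [cross z d / 2]. It does not
    change when [z] moves along [d], so the line stays horizontal. *)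
Lemma hlineE z (d : plane R) r :
  hline (Defs.lift u z) d r = (z + r *: d, u z + r * (cross z d / 2)).
Proof.
case: z d => [x y] [d1 d2]; rewrite /hline /cross /=.
congr pair; first congr pair; rewrite /= /GRing.scale /=.
- by ring.
- by ring.
- by field.
Qed.

Lemma graph_hlineE z (d : plane R) r :
  graph Omega u (hline (Defs.lift u z) d r) ->
  u (z + r *: d) = u z + r * (cross z d / 2).
Proof. by rewrite hlineE => -[z' _ [<- <-]]. Qed.

(* With [k = -1] the segment is followed against [rule_dir]. *)
Lemma rule_lift z (k s : R) : (Omega `\` char_locus Omega u) z ->
  (forall r, 0 <= r <= s -> Omega (z + (r * k) *: rule_dir u z)) ->
  forall r, 0 <= r <= s ->
    u (z + (r * k) *: rule_dir u z) = u z + (r * k) * (cross z (rule_dir u z) / 2).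
Proof.
move=> Cz inO; set d := rule_dir u z in inO *.
have Oz : Omega z by case: Cz.
have in_run (A : set (plane R)) q : 0 <= q -> A z ->
    (forall r, 0 <= r <= q -> A (z + (r * k) *: d)) -> run A z d (q * k).
  move=> q0 Az Ar; apply: (@connected_component_max _ _ ((fun r => r * k) @` `[0, q])).
  - by exists 0; rewrite ?mul0r//= in_itv /= lexx.
  - by move=> _ [r /= + <-]; rewrite in_itv /=; exact: Ar.
  - apply: connected_continuous_connected; first exact: segment_connected.
    apply: continuous_subspaceT => x.
    by apply: cvgM; [exact: cvg_id|exact: cvg_cst].
  - by exists q; rewrite //= in_itv /= q0 lexx.
have rule_in q : 0 <= q -> (forall r, 0 <= r <= q ->
    (Omega `\` char_locus Omega u) (z + (r * k) *: d)) ->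
    Defs.rule Omega u z (hline (Defs.lift u z) d (q * k)).
  by move=> q0 qO; exists (q * k) => //; exact: in_run.
have liftE q : 0 <= q -> (forall r, 0 <= r <= q ->
    (Omega `\` char_locus Omega u) (z + (r * k) *: d)) ->
    u (z + (q * k) *: d) = u z + (q * k) * (cross z d / 2).
  move=> q0 qO; apply: graph_hlineE; apply: (u_ruled Cz).2.
  exact: rule_in.
pose T := [set r | 0 <= r <= s /\ char_locus Omega u (z + (r * k) *: d)].
(* Without characteristic points the segment is part of the rule itself, and [u_ruled] suffices. *)
have [T0|nT] := pselect (T !=set0); last first.
  move=> r rs; apply: liftE; first by case/andP: rs.
  move=> q /andP[q0 qr]; have qs : 0 <= q <= s by apply/andP; split; lra.
  by split; [exact: inO|move=> Cq; apply: nT; exists q].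
have [r1 Tr1] := T0.
have lT : has_lbound T by exists 0 => r [/andP[]].
(* The first characteristic parameter: it belongs to [T] because [gp] and [gq] vanish there by
   continuity. *)
pose r0 := inf T.
have r00 : 0 <= r0 by apply: lb_le_inf => // r [/andP[]].
have r0s : r0 <= s by apply: le_trans (ge_inf lT Tr1) _; case: Tr1 => /andP[].
have cline : continuous (fun r : R => z + (r * k) *: d).
  move=> r; apply: cvgD; first exact: cvg_cst.
  apply: cvgZ; last exact: cvg_cst.
  by apply: cvgM; [exact: cvg_id|exact: cvg_cst].
have Or0 : Omega (z + (r0 * k) *: d) by apply: inO; rewrite r00.
have infT (f : plane R -> R) : {for z + (r0 * k) *: d, continuous f} ->
    (forall y, char_locus Omega u y -> f y = 0) -> f (z + (r0 * k) *: d) = 0.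
  move=> cf f0; apply/eqP; rewrite -[_ == _]negbK; apply/negP => fn0.
  have : \forall r \near r0, f (z + (r * k) *: d) != 0.
    have cfr : f (z + (r * k) *: d) @[r --> r0] --> f (z + (r0 * k) *: d).
      by apply: (cvg_comp (fun r => z + (r * k) *: d) f (cline r0)); exact: cf.
    exact: (cvgr_neq0 _ cfr fn0).
  move=> /nbhs_ballP[e /= e0 He].
  have [r [rs Cr] re] := inf_adherent e0 (conj T0 lT).
  have : f (z + (r * k) *: d) != 0.
    apply: He; rewrite /ball /= distrC ger0_norm.
      by move: re; rewrite -/r0; lra.
    by rewrite subr_ge0; apply: ge_inf.
  by rewrite f0// eqxx.
have Cr0 : char_locus Omega u (z + (r0 * k) *: d).
  split => //.
    by apply: (infT (gp u)); [exact: gp_continuous|move=> y []].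
  by apply: (infT (gq u)); [exact: gq_continuous|move=> y []].
have r0_gt0 : 0 < r0.
  rewrite lt_neqAle r00 andbT; apply/eqP => r0E; case: Cz => _; apply.
  by move: Cr0; rewrite -r0E mul0r scale0r addr0.
have before q : 0 <= q < r0 -> forall r, 0 <= r <= q ->
    (Omega `\` char_locus Omega u) (z + (r * k) *: d).
  move=> /andP[q0 qr0] r /andP[rr0 rq]; have rs : 0 <= r <= s by apply/andP; split; lra.
  split; first exact: inO.
  by move=> Cr; have := ge_inf lT (conj rs Cr); rewrite -/r0; lra.
(* Points of the rule just before [r0] tend to a characteristic point, so [u_extend] applies. It
   covers the whole segment, however many characteristic points follow. *)
have closure_rule :
    closure (Defs.rule Omega u z) (Defs.lift u (z + (r0 * k) *: d)).
  move=> B nB.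
  have : \forall r \near r0, B (Defs.lift u (z + (r * k) *: d)).
    have cu : u @ (z + (r0 * k) *: d) --> u (z + (r0 * k) *: d).
      exact/differentiable_continuous/u_differentiable.
    have cur := cvg_comp (fun r => z + (r * k) *: d) u (cline r0) cu.
    exact: (cvg_pair (cline r0) cur nB).
  move=> /nbhs_ballP[e /= e0 He].
  (* The maximum with 0 keeps [q] on the segment when [e] is large. *)
  pose q := Num.max 0 (r0 - e / 2).
  have qr0 : 0 <= q < r0 by rewrite /q le_max lexx gt_max r0_gt0 /=; lra.
  have qe : r0 - e / 2 <= q by rewrite /q le_max lexx orbT.
  exists (Defs.lift u (z + (q * k) *: d)); split; last first.
    by apply: He; rewrite /ball /= ltr_norml; case/andP: qr0 => *; apply/andP; split; lra.
  have [q0 _] := andP qr0.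
  have := rule_in q q0 (before q qr0).
  by rewrite hlineE -liftE//; exact: before.
have ext := u_extend Cz (ex_intro _ _ (conj closure_rule
  (ex_intro2 _ _ _ Cr0 erefl))).
move=> r /andP[rr0 rs]; apply: graph_hlineE; apply: ext.
exists (r * k) => //; apply: in_run => // q /andP[q0 qr]; apply: inO.
by apply/andP; split; lra.
Qed.

(** The surface contains the lifted segment, so the derivative of [u] along it is the slope of a
    horizontal line; this makes the horizontal gradient at the end orthogonal to the rule. *)
Lemma rule_normal z (k s : R) : (Omega `\` char_locus Omega u) z -> k != 0 -> 0 < s ->
  (forall r, 0 <= r <= s -> Omega (z + (r * k) *: rule_dir u z)) ->
  let e := z + (s * k) *: rule_dir u z in
  gp u e * (rule_dir u z).1 + gq u e * (rule_dir u z).2 = 0.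
Proof.
move=> Cz k0 s0 inO; have lift_r := rule_lift Cz inO.
move: (rule_dir u z) inO lift_r => d inO lift_r e.
have Oe : Omega e by apply: inO; rewrite lexx ltW.
have du := u_differentiable Oe.
have D_left : 'D_(k *: d) u e = k * (cross z d / 2).
  have cD := @diff_derivable _ _ _ u e (k *: d) du.
  (* The segment may leave [Omega] beyond its end, so only the left difference quotient is computed;
     differentiability of [u] makes that enough. *)
  rewrite /derive (cvg_at_leftE _ _ cD); apply: cvg_lim => //.
  apply: cvg_near_cst; near=> h.
  have h0 : h < 0 by near: h; exact: nbhs_left_lt.
  have hs : - s < h by near: h; apply: nbhs_left_gt; rewrite oppr_lt0.
  rewrite /=; have -> : h *: (k *: d) + e = z + ((s + h) * k) *: d.
    by rewrite /e addrC -addrA !scalerA -scalerDl mulrDl.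
  rewrite /= lift_r; last by apply/andP; split; lra.
  rewrite lift_r; last by rewrite lexx ltW.
  by rewrite /GRing.scale /=; field; lra.
have : 'D_(k *: d) u e = k * (d.1 * dx u e + d.2 * dy u e).
  by rewrite derive_plane//= /GRing.scale /=; ring.
rewrite D_left => /(mulfI k0) E; rewrite gpE// gqE//.
have : cross e d = cross z d by rewrite /e /cross /= /GRing.scale /=; ring.
rewrite /cross; rewrite /cross in E => E'.
lra.
Unshelve. all: by end_near. Qed.

Lemma unit_parallel (a b : plane R) : dot a a = 1 -> dot b b = 1 -> cross a b = 0 ->
  b = a \/ b = - a.
Proof.
move=> a1 b1 /(cross0_unit a1) bE; move: (dot b a) bE b1 => r -> .
move=> ra; have : r ^+ 2 = 1.
  transitivity (r ^+ 2 * dot a a); first by rewrite a1 mulr1.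
  by rewrite -ra /dot /= /GRing.scale /=; ring.
move=> /eqP; rewrite sqrf_eq1 => /orP[/eqP->|/eqP->].
  by left; rewrite scale1r.
by right; rewrite scaleN1r.
Qed.

Lemma cvg_sqrt_sumsqr (T : Type) (F : set_system T) (FF : Filter F) (f h : T -> R)
  (a b : R) : f @ F --> a -> h @ F --> b ->
  (fun t => Num.sqrt (f t ^+ 2 + h t ^+ 2)) @ F --> Num.sqrt (a ^+ 2 + b ^+ 2).
Proof.
move=> fa hb; apply: (cvg_comp (fun t => f t ^+ 2 + h t ^+ 2) Num.sqrt).
  exact: (cvgD (cvgM fa fa) (cvgM hb hb)).
exact: sqrt_continuous.
Qed.

Definition hgrad_norm z := Num.sqrt (gp u z ^+ 2 + gq u z ^+ 2).

Lemma hgrad_norm_gt0 z : Omega z -> ~ char_locus Omega u z -> 0 < hgrad_norm z.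
Proof.
move=> Oz nC; have pq : ~ (gp u z = 0 /\ gq u z = 0) by move=> [p0 q0]; apply: nC.
rewrite /hgrad_norm; move: (gp u z) (gq u z) pq => p q pq.
rewrite sqrtr_gt0 lt_neqAle addr_ge0 ?sqr_ge0// andbT eq_sym.
rewrite paddr_eq0 ?sqr_ge0// !sqrf_eq0; apply/negP => /andP[/eqP p0 /eqP q0].
exact: pq.
Qed.

Lemma rule_dir_unit z : Omega z -> ~ char_locus Omega u z ->
  dot (rule_dir u z) (rule_dir u z) = 1.
Proof.
move=> Oz nC; have N0 := hgrad_norm_gt0 Oz nC.
have : hgrad_norm z ^+ 2 = gp u z ^+ 2 + gq u z ^+ 2.
  by rewrite /hgrad_norm; move: (gp u z) (gq u z) => p q; rewrite sqr_sqrtr// addr_ge0 ?sqr_ge0.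
rewrite /dot /rule_dir /pbar /qbar /= -/(hgrad_norm z).
move: (gp u z) (gq u z) (hgrad_norm z) N0 => p q N N0 N2.
have N_neq0 : N != 0 by rewrite gt_eqF.
have N2_neq0 : N ^+ 2 != 0 by rewrite expf_neq0.
transitivity ((p ^+ 2 + q ^+ 2) / N ^+ 2); first by field.
by rewrite -N2 divff.
Qed.

(** Both are unit vectors orthogonal to the nonzero horizontal gradient at the end, one by
    definition and the other by [rule_normal]. The sign is left open, as the segment may have
    crossed the characteristic locus. *)
Lemma rule_dir_at_end z (k s : R) : (Omega `\` char_locus Omega u) z -> k != 0 -> 0 < s ->
  (forall r, 0 <= r <= s -> Omega (z + (r * k) *: rule_dir u z)) ->
  let e := z + (s * k) *: rule_dir u z in ~ char_locus Omega u e ->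
  rule_dir u e = rule_dir u z \/ rule_dir u e = - rule_dir u z.
Proof.
move=> Cz k0 s0 inO e nCe; have Oe : Omega e by apply: inO; rewrite lexx ltW.
have N0 := hgrad_norm_gt0 Oe nCe.
apply: unit_parallel; [by apply: rule_dir_unit; case: Cz|exact: rule_dir_unit|].
have := rule_normal Cz k0 s0 inO; rewrite -/e => E.
rewrite crossC {1}/cross [(rule_dir u e).1]/= [(rule_dir u e).2]/= /pbar /qbar -/(hgrad_norm e).
move: (hgrad_norm e) => N.
transitivity (- (gp u e * (rule_dir u z).1 + gq u e * (rule_dir u z).2) / N).
  by move: (gp u e) (gq u e) (rule_dir u z) => p q d; ring.
by rewrite E oppr0 mul0r.
Qed.

Lemma rule_dir_continuous z : Omega z -> ~ char_locus Omega u z ->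
  {for z, continuous (rule_dir u)}.
Proof.
move=> Oz nC; have N0 := hgrad_norm_gt0 Oz nC.
have cp : gp u @ z --> gp u z := gp_continuous Oz.
have cq : gq u @ z --> gq u z := gq_continuous Oz.
have N_neq0 : hgrad_norm z != 0 by rewrite gt_eqF.
have cN : hgrad_norm @ z --> hgrad_norm z.
  exact (@cvg_sqrt_sumsqr _ _ (nbhs_filter z) _ _ _ _ cp cq).
have cV : (fun y => (hgrad_norm y)^-1) @ z --> (hgrad_norm z)^-1.
  exact: (cvgV N_neq0 cN).
move=> B nB; exact: (cvg_pair (cvgM cq cV) (cvgN (cvgM cp cV)) nB).
Qed.

End Surface.

(** * Orientation of the rules along the curve, and the planar arc *)

Theorem corollary1p4 (R : realType) (c : R -> heis R)
    (c_smooth : smooth_curve c) (c_closed : closed_curve c)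
    (c_graph : graph_over_projection c)
    (c_nonlegendrian : forall th : R, ~ legendrian c th)
    (c_nonplanar : forall I : set R, is_interval I ->
       (exists a b : R, [/\ I a, I b & a < b]) ->
       ~ (exists P : set (heis R), is_plane P /\ c @` I `<=` P)) :
  forall (Omega : set (plane R)) (u : plane R -> R),
    Hminimal Omega u -> spans Omega u c -> ~ C1_ruled_Hminimal Omega u.
Proof.
move=> Omega u [clD uC1 _] [_ cO bO gO] [_ u_ruled u_extend].
have [L L0 c_per] := c_closed.
pose g : R -> plane R := fun t => (c t).1.
have c_der (t : R) : derivable c t 1 := c_smooth 0 t.
have c_cont : continuous c.
  by move=> t; apply: differentiable_continuous; apply/derivable1_diffP.
have dc_cont : continuous (fun t => 'D_1 c t).
  have -> : (fun t => 'D_1 c t) = derive1 c by apply/funext => s; rewrite derive1E.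
  move=> t; apply: differentiable_continuous; apply/derivable1_diffP.
  by have := c_smooth 1 t; rewrite derive1n1.
pose dg : R -> plane R := fun t => ('D_1 c t).1.
have g_cont : continuous g.
  by move=> t; apply: (cvg_comp c fst (c_cont t)); exact: cvg_fst.
have dg_cont : continuous dg.
  by move=> t; apply: (cvg_comp (fun t => 'D_1 c t) fst (dc_cont t)); exact: cvg_fst.
have g_der (t : R) : is_derive t (1 : R) g (dg t) by exact: is_derive_fst.
have g_der1 (t : R) : is_derive t 1 (fun s => (g s).1) (dg t).1.
  by have [dgt <-] := g_der t; exact: is_derive_fst.
have g_der2 (t : R) : is_derive t 1 (fun s => (g s).2) (dg t).2.
  by have [dgt <-] := g_der t; exact: is_derive_snd.
(* As [c] is a graph over its projection, [g] is injective modulo the same period. *)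
have g_inj (s t : R) : g s = g t <-> exists k : int, t = s + k%:~R * L.
  rewrite -c_per; split=> [st|]; last by rewrite /g => ->.
  by apply: c_graph; rewrite ?inE.
have Omega_boundary : Defs.boundary Omega = range g := bO.
have Omega_closed : closed Omega by apply: compact_closed => //; exact: norm_hausdorff.
have Omega_regular : Omega `<=` closure (interior Omega).
  case: clD => U [oU _ _ ->]; apply: closureS.
  by rewrite -open_subsetE//; exact: subset_closure.
have Og := curve_in_Omega Omega_closed Omega_boundary.
have c2 (t : R) : (c t).2 = u (g t).
  have : graph (Defs.boundary Omega) u (c t) by rewrite gO; exists t.
  by case=> z _ zc; rewrite /g -zc.
have du (t : R) : differentiable u (g t) := u_differentiable uC1 (Og t).
have dc2 (t : R) : ('D_1 c t).2 = (dg t).1 * dx u (g t) + (dg t).2 * dy u (g t).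
  have [_ <-] := is_derive_snd (c_der t).
  rewrite (_ : (fun s => _) = u \o g); last by apply/funext => s; exact: c2.
  have gd : differentiable g t by have [/derivable1_diffP] := g_der t.
  have dg1 : 'd g t 1 = dg t by rewrite -deriveE//; have [_ ->] := g_der t.
  rewrite deriveE; last exact: differentiable_comp.
  by rewrite diff_comp//= dg1 -deriveE// derive_plane.
pose S (t : R) := gp u (g t) * (dg t).1 + gq u (g t) * (dg t).2.
(* If [S t] vanished, the velocity of [c] would be the combination of [X1] and [X2] with the
   components of [dg t] as coefficients. *)
have S0 t : S t != 0.
  apply/eqP => S0; apply: (c_nonlegendrian t).
  exists (dg t).1, (dg t).2; rewrite derive1E.
  have := dc2 t; move: S0; rewrite /S gpE// gqE// /X1 /X2 -/(g t) /dg.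
  move: (g t) ('D_1 c t) (dx u (g t)) (dy u (g t)) => [x y] [[a b] h] px py /= E hE; congr pair.
    by congr pair; rewrite /= /GRing.scale /=; ring.
  by rewrite /= /GRing.scale /= hE; move: E; lra.
have nC t : ~ char_locus Omega u (g t).
  by move=> [_ p0 q0]; have := S0 t; rewrite /S p0 q0 !mul0r addr0 eqxx.
have OC t : (Omega `\` char_locus Omega u) (g t) by split; [exact: Og|exact: nC].
have gcomp (f : plane R -> R) : (forall z, Omega z -> {for z, continuous f}) ->
    continuous (fun t => f (g t)).
  by move=> cf t; apply: (cvg_comp g f (g_cont t)); exact: cf.
have S_cont : continuous S.
  move=> t; apply: cvgD; apply: cvgM.
  - by apply: gcomp; exact: gp_continuous.
  - by apply: cvg_fst_comp; exact: dg_cont.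
  - by apply: gcomp; exact: gq_continuous.
  - by apply: cvg_snd_comp; exact: dg_cont.
(* The sign [k1] orients the rules so that their determinant with the velocity [dg] is positive all
   along the curve. *)
have [k1 k1E S_sign] := same_sign S_cont S0.
pose v (t : R) := k1 *: rule_dir u (g t).
have v_cont : continuous v.
  move=> t; apply: cvgZ; first exact: cvg_cst.
  apply: (cvg_comp g (rule_dir u) (g_cont t)).
  exact: (rule_dir_continuous uC1).
have v_unit t : dot (v t) (v t) = 1.
  have := rule_dir_unit (Og t) (nC t); rewrite /v.
  move: (rule_dir u (g t)) => d; rewrite /dot /= /GRing.scale /=.
  by case: k1E => ->; rewrite ?mul1r// !mulN1r !mulrNN.
have v_transverse t : 0 < cross (v t) (dg t).
  rewrite /v crossZl (_ : _ * _ = (k1 * S t) / hgrad_norm u (g t)).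
    by rewrite divr_gt0//; apply: hgrad_norm_gt0 (Og t) (nC t).
  rewrite /cross /rule_dir /pbar /qbar /= -/(hgrad_norm u (g t)) /S.
  by move: (hgrad_norm _ _) (gp _ _) (gq _ _) (dg t) => N p q d; ring.
have [k2 k2E k2_in] := inward_side L0 g_inj g_der1 g_der2 g_cont dg_cont v_cont v_unit
  v_transverse Omega_closed Omega_boundary Omega_regular.
(* The second sign [k2] turns [v] inwards, so that [w] is [rule_dir] up to the total sign [k]. *)
pose k := k2 * k1; pose w (t : R) := k2 *: v t.
have k20 : k2 != 0 by case: k2E => ->; rewrite ?oppr_eq0 ?oner_eq0.
have k10 : k1 != 0 by case: k1E => ->; rewrite ?oppr_eq0 ?oner_eq0.
have wE t r : r *: w t = (r * k) *: rule_dir u (g t).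
  by rewrite /w /v /k !scalerA mulrA.
have w_cont : continuous w.
  by move=> t; apply: cvgZ; [exact: cvg_cst|exact: v_cont].
have w_unit t : dot (w t) (w t) = 1.
  have := v_unit t; rewrite /w; move: (v t) => d; rewrite /dot /= /GRing.scale /=.
  by case: k2E => ->; rewrite ?mul1r// !mulN1r !mulrNN.
have w_inward (t0 : R) : exists2 e : R, 0 < e &
    forall t, `|t - t0| < e -> forall s, 0 < s < e ->
      interior Omega (g t + s *: w t) /\ ~ Omega (g t - s *: w t).
  have [e e0 He] := k2_in t0; exists e => // t te s se.
  rewrite /w (scalerA s k2 (v t)); exact: (He t te s se).
have seg_rule t s : seg_in g w Omega t s ->
    forall r, 0 <= r <= s -> Omega (g t + (r * k) *: rule_dir u (g t)).
  by move=> ts r rs; rewrite -wE; exact: ts.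
have w_rule t s t' : 0 < s -> seg_in g w Omega t s -> g t' = g t + s *: w t ->
    w t' = w t \/ w t' = - w t.
  move=> s0 /seg_rule ts gt'; rewrite /w /v gt' wE.
  have [||->|->] := rule_dir_at_end uC1 u_ruled u_extend (OC t) _ s0 ts.
  - by rewrite /k mulf_neq0.
  - by rewrite -wE -gt'.
  - by left.
  - by right; rewrite !scalerN.
have w_arc (t0 : R) : exists2 e : R, 0 < e &
    forall a s t, `|a - t0| < e -> `|s - t0| < e -> `|t - t0| < e -> s < t ->
      0 < k2 * cross (w a) (g t - g s).
  have [e e0 He] := near_arc_transverse g_der1 g_der2 g_cont dg_cont v_cont v_transverse t0.
  exists e => // a s t ae se te st; rewrite /w crossZl mulrA.
  by have := He a s t ae se te st; case: k2E => ->; rewrite ?mulrNN !mul1r.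
have w_lift t s r : seg_in g w Omega t s -> 0 <= r <= s ->
    u (g t + r *: w t) = u (g t) + r * (cross (g t) (w t) / 2).
  move=> /seg_rule ts rs; rewrite wE (rule_lift uC1 u_ruled u_extend (OC t) ts rs).
  by rewrite -[w t]scale1r wE crossZr mul1r; field.
have [e e0 [X HX]] := arc_in_plane L0 g_inj g_cont w_cont w_unit cO Omega_boundary
  w_inward w_rule w_arc w_lift.
apply: (c_nonplanar `]- e, e[%classic); first exact: interval_is_interval.
  exists (- (e / 2)), (e / 2); rewrite /= !in_itv /=.
  by split; [apply/andP; split; lra..|lra].
(* The horizontal plane at the point over [X]: its equation is [a.2 - u X = cross X a.1 / 2],
   rearranged. *)
exists [set a | X.2 / 2 * a.1.1 + (- (X.1 / 2)) * a.1.2 + 1 * a.2 = u X]; split.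
  exists (X.2 / 2), (- (X.1 / 2)), 1, (u X); split => //.
  by apply/eqP => -[_ _ /eqP]; rewrite oner_eq0.
move=> _ [t + <-]; rewrite /= in_itv /= -ltr_norml => /HX.
rewrite -c2 /cross -/(g t) => E; move: E; lra.
Qed.
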